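(* Let $\lambda>0$ and let $\{(N(t),I(t)),\,t\ge 0\}$ be the selling/incentive process described in the context with parameters $k=1$ and $\lambda$. Then for every $t\ge 0$ the distribution of $N(t)$ is $$P(N(t)=n)=e^{-t\lambda}\left(1-e^{-t\lambda}\right)^{n-1},\qquad n=1,2,\ldots,$$ with probability generating function $$P(s,t)=\sum_{n\ge1}P(N(t)=n)s^n=\frac{e^{-\lambda t}s}{1-(1-e^{-\lambda t})s},$$ mean $E\{N(t)\}=e^{t\lambda}$ and variance $\mathrm{Var}\{N(t)\}=e^{t\lambda}(e^{t\lambda}-1)$; and $\{N(t),t\ge0\}$ is the Yule–Furry process.
   Context: Process: $\{I(t),t\ge 0\}$ is a continuous-time stochastic process with values in $\{0,1,2,\ldots\}$, nondecreasing in $t$, with $I(0)=0$. For a fixed integer $k\ge1$, $N(t)=1+kI(t)$, so $N(0)=1$. For all $t\ge 0$ and $n\ge 0$ (with $P(I(t)=n)>0$), as $\Delta t\downarrow 0$, $$P\big(I(t+\Delta t)-I(t)=r\mid I(t)=n\big)=\begin{cases}1-\lambda_n\Delta t+o(\Delta t), & r=0,\\ \lambda_n\Delta t+o(\Delta t), & r=1,\\ o(\Delta t), & r\ge 2,\end{cases}$$ where $\lambda_n=(nk+1)\lambda$, $\lambda>0$, and the $o(\Delta t)$ terms do not depend on $t$. The Yule–Furry process with rate $\lambda$ is the linear pure birth process $\{Y(t),t\ge0\}$ on $\{1,2,\ldots\}$ with $Y(0)=1$: given $Y(t)=n$, the increment over $(t,t+\Delta t]$ equals $1$ with probability $n\lambda\Delta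 t+o(\Delta t)$, equals $0$ with probability $1-n\lambda\Delta t+o(\Delta t)$, and equals $r\ge 2$ with probability $o(\Delta t)$ (same convention on the $o(\Delta t)$ terms). The convention $0^0=1$ is used at $t=0$; the generating function is considered for $|s|\le 1$. *)

(* Defs.v *)
From mathcomp Require Import all_boot all_order all_algebra.
From mathcomp Require Import all_classical all_reals all_analysis.
Set Implicit Arguments.
Unset Strict Implicit.
Unset Printing Implicit Defensive.
Import Order.TTheory GRing.Theory Num.Theory.
Import numFieldNormedType.Exports.
Local Open Scope classical_set_scope.
Local Open Scope ring_scope.

(* Pr(A | B); only meaningful when 0 < P B. *)
Definition cond_pr d (T : measurableType d) (R : realType)
    (P : probability T R) (A B : set T) : R :=
  fine (P (A `&` B)) / fine (P B).

(* Processes are indexed by the time t : R; only the times t >= 0 matter.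
   The increment X (t + h) - X t equals r is written X (t + h) = X t + r, so
   as not to use truncated subtraction on nat. For each n and r the error term
   err r is a single function of the step h, i.e. it does not depend on t. *)
Definition birth_increments d (T : measurableType d) (R : realType)
    (P : probability T R) (rate : nat -> R) (X : R -> T -> nat) : Prop :=
  forall n : nat, exists err : nat -> R -> R,
    (forall r, err r =o_ (0^'+) (fun h : R => h)) /\
    forall (t h : R) (r : nat), 0 <= t -> 0 < h ->
      (0 < P [set w | X t w = n])%E ->
      cond_pr P [set w | X (t + h) w = (X t w + r)%N] [set w | X t w = n] =
      match r with
      | 0%N => 1 - rate n * h + err 0%N h
      | 1%N => rate n * h + err 1%N h
      | _ => err r h
      end.

(* No Markov property is required: the infinitesimal conditions only condition
   on the current state. *)
Record pure_birth_process d (T : measurableType d) (R : realType)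
    (P : probability T R) (init : nat) (rate : nat -> R)
    (X : R -> T -> nat) : Prop := PureBirthProcess {
  pure_birth_measurable : forall t, 0 <= t -> measurable_fun setT (X t);
  pure_birth_init : forall w, X 0 w = init;
  pure_birth_nondecreasing :
    forall (s t : R) w, 0 <= s -> s <= t -> (X s w <= X t w)%N;
  pure_birth_increments : birth_increments P rate X }.

Definition selling_incentive_process d (T : measurableType d) (R : realType)
    (P : probability T R) (k : nat) (lambda : R)
    (N I : R -> T -> nat) : Prop :=
  pure_birth_process P 0%N (fun n => (n * k + 1)%:R * lambda) I /\
  forall t w, 0 <= t -> N t w = (1 + k * I t w)%N.

Definition Yule_Furry_process d (T : measurableType d) (R : realType)
    (P : probability T R) (lambda : R) (Y : R -> T -> nat) : Prop :=
  (forall t w, 0 <= t -> (1 <= Y t w)%N) /\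
  pure_birth_process P 1%N (fun n => n%:R * lambda) Y.

(* Main.v *)
Require Import Defs.
From mathcomp Require Import all_boot all_order all_algebra.
From mathcomp Require Import all_classical all_reals all_analysis.
From mathcomp Require Import measurable_realfun ring lra.
Import Order.TTheory GRing.Theory Num.Theory.
Import numFieldNormedType.Exports.
Local Open Scope classical_set_scope.
Local Open Scope ring_scope.

(** The incentive count I is a pure birth process whose rate in state n is
    (n + 1) lambda. The increment conditions condition on the current state
    only, yet that is enough to determine every one-dimensional law: splitting
    on the state at time t gives, for p_n(t) = P(I(t) = n),
      p_n(t + h) = (1 - rate_n h) p_n(t) + h rate_(n-1) p_(n-1)(t) + o(h),
    with an error that is uniform in t (lemma birth_forward_equations). These
    are Kolmogorov's forward equations in finite-difference form. Because the
    error is uniform, no derivative has to be taken: the difference of two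
    solutions with the same initial values is controlled by m steps of length
    t / m, which accumulate an error of at most e t for every e > 0, so the
    solution is unique, by induction on n (lemmas linear_decay_eq0 and
    forward_equations_unique).

    It remains to exhibit a solution. With x = exp (- lambda t), the geometric
    probabilities x (1 - x)^n solve the forward equations: replacing t by t + h
    multiplies x by 1 - z with z = lambda h + O(h^2), and the first-order
    expansion in z is exactly the birth term minus the death term (lemma
    geometric_law_forward). Hence N(t) = I(t) + 1 is geometric with parameter x.

    The generating function is then a geometric series, and the mean and the
    variance are series which telescope explicitly (lemmas expectation_nat,
    geometric_mean_series and geometric_variance_series); the variance is the
    expectation of the nonnegative variable (N(t) - 1/x)^2.

    Finally N = I + 1 has the same increments as I, and the rate of I in state
    n is that of a Yule-Furry process in state n + 1 (lemma
    pure_birth_shift). *)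

Set Implicit Arguments.
Unset Strict Implicit.
Unset Printing Implicit Defensive.

(** * Forward equations and uniqueness of their solution *)

Definition inflow (R : realType) (rate : nat -> R) (p : nat -> R -> R)
    (n : nat) (t : R) : R :=
  if n is m.+1 then rate m * p m t else 0.

(** Kolmogorov's equations p_n' = - rate_n p_n + rate_(n-1) p_(n-1) in
    finite-difference form. The quantifier over t lies inside the filter on h:
    the error is uniform in t, so that errors add up along a subdivision of
    [0, t]. *)
Definition forward_equations (R : realType) (rate : nat -> R)
    (p : nat -> R -> R) : Prop :=
  forall n (e : R), 0 < e -> \forall h \near 0^'+, forall t : R, 0 <= t ->
    `|p n (t + h) - ((1 - rate n * h) * p n t
       + h * inflow rate p n t)| <= e * h.

(** A one-step error e h turns into at most e t after the m steps of length
    t / m, since each step contracts by the factor 1 - a h in [0, 1]. *)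
Lemma linear_decay_eq0 (R : realType) (a : R) (f : R -> R) :
  0 <= a -> f 0 = 0 ->
  (forall e, 0 < e -> \forall h \near 0^'+, forall t, 0 <= t ->
     `|f (t + h) - (1 - a * h) * f t| <= e * h) ->
  forall t, 0 <= t -> f t = 0.
Proof.
move=> a0 f0 step t t0; apply/eqP; rewrite -normr_le0.
suff fle e : 0 < e -> `|f t| <= e * t.
  rewrite leNgt; apply/negP => ft0.
  have e0 : 0 < `|f t| / (2 * (1 + t)) by rewrite divr_gt0 //; lra.
  have := fle _ e0; rewrite mulrAC ler_pdivlMr; last by lra.
  nra.
move=> e0; have [->|tn0] := eqVneq t 0; first by rewrite f0 normr0 mulr0.
have {tn0} t0' : 0 < t by rewrite lt_def tn0.
have small : \forall h \near (0 : R)^'+, (0 < h) /\ (a * h <= 1) /\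
    forall t, 0 <= t -> `|f (t + h) - (1 - a * h) * f t| <= e * h.
  near=> h; split; first by near: h; exact: nbhs_right_gt.
  split; last by near: h; exact: step.
  have h1 : h < (1 + a)^-1.
    by near: h; apply: nbhs_right_lt; rewrite invr_gt0; lra.
  have h0 : 0 < h by near: h; exact: nbhs_right_gt.
  have : (1 + a) * h <= 1.
    by rewrite mulrC -ler_pdivlMr ?mul1r; [exact: ltW|lra].
  by lra.
(* The step is t / (m + 1), as harmonic m is 1 / (m + 1). *)
have cvgh : t * harmonic m @[m --> \oo] --> (0 : R)^'+.
  have cv : t * harmonic m @[m --> \oo] --> (0 : R).
    by rewrite -[X in _ --> X](mulr0 t); apply: cvgMr; exact: cvg_harmonic.
  move=> A A0.
  have cvA : \forall m \near \oo, 0 < t * harmonic m -> A (t * harmonic m).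
    exact: cv A0.
  suff : \forall m \near \oo, A (t * harmonic m) by [].
  by apply: filterS cvA => m; apply; rewrite mulr_gt0 // harmonic_gt0.
have [m _ /(_ _ (leqnn m))] := cvgh _ small.
rewrite /= => -[h0 [ah1 stp]].
set h := t * harmonic m in h0 ah1 stp.
have errors_add_up j : `|f (j%:R * h)| <= e * (j%:R * h).
  elim: j => [|j IH]; first by rewrite mul0r f0 normr0 mulr0.
  have jh0 : 0 <= j%:R * h by rewrite mulr_ge0 // ltW.
  have -> : j.+1%:R * h = j%:R * h + h by rewrite -natr1; ring.
  rewrite -[X in `|X|](subrK ((1 - a * h) * f (j%:R * h))).
  apply: (le_trans (ler_normD _ _)).
  rewrite mulrDr addrC; apply: lerD; last exact: stp.
  apply: le_trans IH; rewrite normrM ler_piMl // ger0_norm; last by lra.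
  by have := mulr_ge0 a0 (ltW h0); lra.
have := errors_add_up m.+1; rewrite /h /harmonic /=.
by rewrite mulrCA mulfV ?mulr1 // pnatr_eq0.
Unshelve. all: by end_near.
Qed.

(** The equation for n involves only p_n and p_(n-1), so the difference of two
    solutions decays linearly once they agree at n - 1. *)
Lemma forward_equations_unique (R : realType) (rate : nat -> R)
    (p q : nat -> R -> R) :
  (forall n, 0 <= rate n) -> (forall n, p n 0 = q n 0) ->
  forward_equations rate p -> forward_equations rate q ->
  forall n t, 0 <= t -> p n t = q n t.
Proof.
move=> rate0 pq0 fp fq; have step n :
    (forall t, 0 <= t -> inflow rate p n t = inflow rate q n t) ->
    forall t, 0 <= t -> p n t = q n t.
  move=> IH t t0; apply/eqP; rewrite -subr_eq0; apply/eqP.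
  pose f u := p n u - q n u; have f0 : f 0 = 0 by rewrite /f pq0 subrr.
  apply: (linear_decay_eq0 (rate0 n) f0 _ t0).
  move=> e e0; have e20 : 0 < e / 2 by lra.
  near=> h => s s0.
  have Hp : forall u, 0 <= u -> `|p n (u + h) - ((1 - rate n * h) * p n u
       + h * inflow rate p n u)| <= e / 2 * h by near: h; exact: fp.
  have Hq : forall u, 0 <= u -> `|q n (u + h) - ((1 - rate n * h) * q n u
       + h * inflow rate q n u)| <= e / 2 * h by near: h; exact: fq.
  have := Hp _ s0; have := Hq _ s0; rewrite (IH _ s0) !ler_norml /f; lra.
elim=> [|n IH]; apply: step => // t t0.
by rewrite /inflow IH.
Unshelve. all: by end_near.
Qed.

(** * State probabilities of a pure birth process *)

Lemma measurable_level_set d (T : measurableType d) (X : T -> nat) (n : nat) :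
  measurable_fun setT X -> measurable [set w | X w = n].
Proof.
move=> mX; rewrite -[X in measurable X]setTI.
exact: (mX measurableT [set n]).
Qed.

(** Condition on the state m <= n at time t: paths are nondecreasing, so no
    other state can lead to n. States of probability zero, where the increment
    condition is silent, contribute nothing to either side. Only m = n and
    m = n - 1 have a term of order h; the finitely many remainders are bounded
    together. *)
Lemma birth_forward_equations d (T : measurableType d) (R : realType)
    (P : probability T R) (init : nat) (rate : nat -> R) (X : R -> T -> nat) :
  pure_birth_process P init rate X ->
  forward_equations rate (fun n t => fine (P [set w | X t w = n])).
Proof.
move=> bX; have mX := pure_birth_measurable bX.
have incX := pure_birth_nondecreasing bX.
have [err errP] := choice (pure_birth_increments bX).
pose p n t := fine (P [set w | X t w = n]); rewrite -/p => n e e0.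
have mL t m : 0 <= t -> measurable [set w | X t w = m].
  by move=> t0; apply: measurable_level_set; exact: mX.
have p01 m t : 0 <= t -> 0 <= p m t <= 1.
  move=> t0; apply/andP; split; first exact: fine_ge0.
  rewrite -lee_fin fineK; first by apply: probability_le1; exact: mL.
  by apply: fin_num_measure; exact: mL.
(* The increment probability without its error term. *)
pose lead m r h : R := match r with
  | 0 => 1 - rate m * h | 1 => rate m * h | _ => 0 end.
have total t h : 0 <= t -> 0 < h ->
    p n (t + h) =
    \sum_(m < n.+1) p m t * (lead m (n - m)%N h + err m (n - m)%N h).
  move=> t0 h0; have th0 : 0 <= t + h by lra.
  pose F m := [set w | X (t + h) w = n] `&` [set w | X t w = m].
  have mF m : measurable (F m) by apply: measurableI; exact: mL.
  have -> : p n (t + h) = fine (\sum_(m < n.+1) P (F m))%E.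
    rewrite /p -measure_bigsetU //; last first.
      by move=> i j _ _ [w [[_ <-] [_ <-]]].
    congr (fine (P _)); apply/seteqP; split=> [w /= Xn|w].
      rewrite -bigcup_mkord; exists (X t w) => //=.
      by rewrite ltnS -Xn; apply: incX => //; lra.
    by rewrite -bigcup_mkord => -[m _ []].
  rewrite -sum_fine; last by move=> m _; rewrite fin_num_measure.
  apply: eq_bigr => m _.
  have [Pm0|Pm0] := leP (P [set w | X t w = m]) 0%E.
    have Pz : P [set w | X t w = m] = 0%E by apply/eqP; rewrite -measure_le0.
    rewrite /p Pz mul0r; apply/eqP; rewrite fine_eq0 ?fin_num_measure //.
    rewrite -measure_le0 -Pz le_measure // ?inE //; first exact: mL.
    by move=> w [].
  have := (errP m).2 t h (n - m)%N t0 h0 Pm0.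
  rewrite /cond_pr => /(congr1 (fun x => p m t * x)).
  rewrite [LHS]mulrCA divff ?mulr1; last first.
    by rewrite gt_eqF // fine_gt0 // Pm0 ltey_eq fin_num_measure //; exact: mL.
  rewrite (_ : _ `&` _ = F m); last first.
    have mn : (m <= n)%N by rewrite -ltnS.
    by rewrite /F; apply/seteqP; split=> w /= [Xw Xt]; rewrite Xw Xt subnKC.
  by move=> ->; case: (n - m)%N => [|[|r]]; rewrite /lead ?add0r.
have leadE t h : \sum_(m < n.+1) p m t * lead m (n - m)%N h =
    (1 - rate n * h) * p n t + h * inflow rate p n t.
  rewrite big_ord_recr /= subnn addrC /lead mulrC; congr (_ + _).
  rewrite /inflow; case: (n) => [|k]; first by rewrite big_ord0 mulr0.
  rewrite big_ord_recr /= subSnn big1 ?add0r; first by ring.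
  by move=> i _; rewrite subSn ?(ltnW (ltn_ord i)) // -subnSK //= mulr0.
have en0 : 0 < e / n.+1%:R by rewrite divr_gt0.
near=> h => t t0; have h0 : 0 < h by near: h; exact: nbhs_right_gt.
rewrite total // -leadE -sumrB.
apply: le_trans (ler_norm_sum _ _ _) _.
have errh : forall m : 'I_n.+1, `|err m (n - m)%N h| <= e / n.+1%:R * h.
  near: h; apply: filter_forall => m; near=> h.
  have h0 : 0 < h by near: h; exact: nbhs_right_gt.
  rewrite -{2}(gtr0_norm h0); near: h.
  by apply: (eqoP _ _ _).1 en0; exact: (errP m).1.
apply: (@le_trans _ _ (\sum_(m < n.+1) e / n.+1%:R * h)).
  apply: ler_sum => m _; rewrite -mulrBr addrAC subrr add0r normrM.
  apply: le_trans (errh m); rewrite ler_piMl //.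
  by have /andP[? ?] := p01 m t t0; rewrite ger0_norm.
rewrite sumr_const card_ord -[leLHS]mulr_natl mulrA.
by rewrite mulrCA mulfV ?mulr1 // pnatr_eq0.
Unshelve. all: by end_near.
Qed.

Lemma birth_law0 d (T : measurableType d) (R : realType)
    (P : probability T R) (init : nat) (rate : nat -> R) (X : R -> T -> nat) :
  pure_birth_process P init rate X ->
  forall n, P [set w | X 0 w = n] = ((n == init)%:R : R)%:E.
Proof.
move=> bX n; have X0 := pure_birth_init bX.
case: eqVneq => [->|ninit].
  rewrite (_ : [set w | _] = [set: T]) ?probability_setT //.
  by apply/seteqP; split=> w //= _; exact: X0.
rewrite (_ : [set w | _] = set0) ?measure0 //.
by apply/seteqP; split=> w //=; rewrite X0 => /esym/eqP; rewrite (negbTE ninit).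
Qed.

(** * The geometric solution *)

(** The law on n = 0, 1, ... of a shifted geometric variable: N(t) - 1, not
    N(t). *)
Definition geometric_law (R : realType) (lambda : R) (n : nat) (t : R) : R :=
  expR (- (t * lambda)) * (1 - expR (- (t * lambda))) ^+ n.

(** The bound n^2 propagates because (n + 1)^2 leaves 2 n + 1 >= n to spare for
    the term n a^(n-1) b^2 created by one more factor a + b. At n = 0 the
    coefficient n is 0, whatever the default value n.-1 = 0 yields. *)
Lemma exprD_linear_approx (R : realDomainType) (a b : R) n :
  0 <= a -> 0 <= b -> a + b <= 1 ->
  `|(a + b) ^+ n - (a ^+ n + n%:R * a ^+ n.-1 * b)| <= n%:R ^+ 2 * b ^+ 2.
Proof.
move=> a0 b0 ab1; have a1 : a <= 1 by lra.
elim: n => [|n IH].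
  by rewrite !expr0 !mul0r addr0 subrr normr0 expr0n mul0r.
have -> : (a + b) ^+ n.+1 - (a ^+ n.+1 + n.+1%:R * a ^+ n.+1.-1 * b) =
    ((a + b) ^+ n - (a ^+ n + n%:R * a ^+ n.-1 * b)) * (a + b) +
    n%:R * a ^+ n.-1 * b ^+ 2.
  by case: n {IH} => [|n] /=; rewrite ?expr0 ?expr1 -?natr1 ?exprS; ring.
apply: (le_trans (ler_normD _ _)).
have -> : n.+1%:R ^+ 2 * b ^+ 2 =
    n%:R ^+ 2 * b ^+ 2 + (2 * n%:R + 1) * b ^+ 2 :> R by rewrite -natr1; ring.
have n0 : 0 <= n%:R :> R by [].
apply: lerD.
  rewrite normrM (ger0_norm (addr_ge0 a0 b0)); apply: le_trans IH.
  by rewrite ler_piMr.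
rewrite ger0_norm; last by rewrite !mulr_ge0 ?exprn_ge0.
apply: ler_wpM2r; first exact: exprn_ge0.
have : n%:R * a ^+ n.-1 <= n%:R by rewrite ler_piMr // exprn_ile1.
by lra.
Qed.

(** Moving from t to t + h replaces x = exp (- t lambda) by x (1 - z), where
    z = 1 - exp (- h lambda). Expanding x (1 - z) (1 - x + x z)^n to first order
    in z gives q_n + z (n q_(n-1) - (n + 1) q_n); the remainder is O(z^2), and
    z differs from h lambda by O(h^2), both uniformly for x in [0, 1]. *)
Lemma geometric_law_forward (R : realType) (lambda : R) : 0 < lambda ->
  forward_equations (fun n => (n * 1 + 1)%:R * lambda) (geometric_law lambda).
Proof.
move=> l0 n e e0; near=> h => t t0.
have h0 : 0 < h by near: h; exact: nbhs_right_gt.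
set x := expR (- (t * lambda)).
have x0 : 0 <= x by exact: expR_ge0.
have x1 : x <= 1 by rewrite -expR0 ler_expR oppr_le0 mulr_ge0 // ltW.
pose u := h * lambda; have u0 : 0 < u by exact: mulr_gt0.
pose z := 1 - expR (- u).
have z0 : 0 <= z by rewrite subr_ge0 -expR0 ler_expR; lra.
have z1 : z <= 1 by have := expR_gt0 (- u); rewrite /z; lra.
have zu : z <= u by have := expR_ge1Dx (- u); rewrite /z; lra.
(* From exp (- u) <= 1 / (1 + u). *)
have zlo : u - u ^+ 2 <= z.
  have E1 := expR_ge1Dx u; have Ep := expR_gt0 (- u).
  have EE : expR u * expR (- u) = 1 by rewrite -expRD subrr expR0.
  rewrite /z expr2; nra.
pose a := 1 - x; have a0 : 0 <= a by rewrite /a; lra.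
have a1 : a <= 1 by rewrite /a; lra.
have qh : geometric_law lambda n (t + h) = x * (1 - z) * (a + x * z) ^+ n.
  rewrite /geometric_law mulrDl opprD expRD -/x -/u /a /z.
  by congr (_ * _ ^+ _); ring.
have inflowE :
    h * inflow (fun n => (n * 1 + 1)%:R * lambda) (geometric_law lambda) n t
    = u * (n%:R * (x * a ^+ n.-1)).
  rewrite /inflow /u /geometric_law -/x -/a.
  case: (n) => [|m] /=; first by rewrite mul0r !mulr0.
  by rewrite muln1 addn1; ring.
(* Multiplied by x, this reads n x^2 (1 - x)^(n-1) = n (q_(n-1) - q_n): it turns
   the term of first order in z into a combination of q_(n-1) and q_n. *)
have pascal : n%:R * a ^+ n.-1 * x = n%:R * a ^+ n.-1 - n%:R * a ^+ n.
  by case: (n) => [|m] /=; rewrite ?mul0r ?subrr // exprS /a; ring.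
have n0 : 0 <= n%:R :> R by [].
have := @exprD_linear_approx R a (x * z) n a0 (mulr_ge0 x0 z0).
rewrite (_ : a + x * z <= 1); last by rewrite /a; nra.
move=> /(_ isT).
set rho := _ - _ => rhob.
have rhoz : `|rho| <= n%:R ^+ 2 * z ^+ 2.
  apply: le_trans rhob _; apply: ler_wpM2l; first exact: exprn_ge0.
  by rewrite exprMn ler_piMl ?exprn_ge0 // exprn_ile1.
have an0 : 0 <= a ^+ n <= 1 by rewrite exprn_ge0 // exprn_ile1.
have am0 : 0 <= a ^+ n.-1 <= 1 by rewrite exprn_ge0 // exprn_ile1.
rewrite qh inflowE muln1 {1}/geometric_law -/x -/a.
set L := (X in `|X|).
have LE : L = x * (1 - z) * rho - n%:R * a ^+ n.-1 * x * x * z ^+ 2 +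
   (u - z) * (x * ((n%:R + 1) * a ^+ n - n%:R * a ^+ n.-1)).
  have -> : L = x * (1 - z) * (rho + (a ^+ n + n%:R * a ^+ n.-1 * (x * z))) -
      ((1 - (n%:R + 1) * u) * (x * a ^+ n) + u * (n%:R * (x * a ^+ n.-1))).
    by rewrite /L /rho subrK natrD /u; ring.
  have -> : n%:R * a ^+ n.-1 * (x * z) =
      z * (n%:R * a ^+ n.-1 - n%:R * a ^+ n) by rewrite -pascal; ring.
  by rewrite pascal; ring.
have z2u : z ^+ 2 <= u ^+ 2 by rewrite ler_sqr ?nnegrE // ltW.
(* n^2 + 3 n + 1 is the sum of the constants n^2, n and 2 n + 1 in b1, b2 and
   b3. *)
have hK : (n%:R ^+ 2 + 3 * n%:R + 1) * u ^+ 2 <= e * h.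
  have K0 : 0 < n%:R ^+ 2 + 3 * n%:R + 1 :> R by nra.
  have : h < e / ((n%:R ^+ 2 + 3 * n%:R + 1) * lambda ^+ 2).
    by near: h; apply: nbhs_right_lt; rewrite divr_gt0 // mulr_gt0 ?exprn_gt0.
  rewrite ltr_pdivlMr; last by rewrite mulr_gt0 ?exprn_gt0.
  move=> /ltW /(ler_wpM2r (ltW h0)).
  set K := _ + 1; rewrite (_ : K * u ^+ 2 = h * (K * lambda ^+ 2) * h) //.
  by rewrite /u; ring.
apply: le_trans hK.
rewrite LE.
have b1 : `|x * (1 - z) * rho| <= n%:R ^+ 2 * u ^+ 2.
  rewrite normrM ger0_norm; last by rewrite mulr_ge0 //; lra.
  apply: (@le_trans _ _ `|rho|); first by rewrite ler_piMl //; nra.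
  by apply: le_trans rhoz _; apply: ler_wpM2l => //; exact: exprn_ge0.
have b2 : `|n%:R * a ^+ n.-1 * x * x * z ^+ 2| <= n%:R * u ^+ 2.
  rewrite ger0_norm; last by rewrite !mulr_ge0 ?exprn_ge0.
  apply: ler_pM; rewrite ?mulr_ge0 ?exprn_ge0 //.
  by rewrite -!mulrA ler_piMr // !mulr_ile1 ?mulr_ge0 ?exprn_ge0 ?exprn_ile1.
have b3 : `|(u - z) * (x * ((n%:R + 1) * a ^+ n - n%:R * a ^+ n.-1))|
    <= (2 * n%:R + 1) * u ^+ 2.
  rewrite normrM mulrC; apply: ler_pM => //; last first.
    by rewrite ger0_norm; lra.
  rewrite normrM ger0_norm //.
  apply: (@le_trans _ _ (`|(n%:R + 1) * a ^+ n - n%:R * a ^+ n.-1|)).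
    by rewrite ler_piMl.
  rewrite ler_norml; nra.
have := ler_normD (x * (1 - z) * rho - n%:R * a ^+ n.-1 * x * x * z ^+ 2)
  ((u - z) * (x * ((n%:R + 1) * a ^+ n - n%:R * a ^+ n.-1))).
have := ler_normB (x * (1 - z) * rho) (n%:R * a ^+ n.-1 * x * x * z ^+ 2).
lra.
Unshelve. all: by end_near.
Qed.

Lemma selling_incentive_law d (T : measurableType d) (R : realType)
    (P : probability T R) (lambda : R) (N I : R -> T -> nat) :
  0 < lambda -> selling_incentive_process P 1 lambda N I ->
  forall n t, 0 <= t -> P [set w | I t w = n] = (geometric_law lambda n t)%:E.
Proof.
move=> l0 [bI _] n t t0.
rewrite -[LHS]fineK; last first.
  apply: fin_num_measure; apply: measurable_level_set.
  exact: (pure_birth_measurable bI).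
congr (_%:E); move: n t t0.
apply: (forward_equations_unique _ _ (birth_forward_equations bI)
  (geometric_law_forward l0)).
  by move=> n; apply: mulr_ge0 => //; exact: ltW.
move=> n; rewrite (birth_law0 bI) /geometric_law mul0r oppr0 expR0 subrr mul1r.
by rewrite expr0n.
Qed.

(** * Moments of the geometric law *)

(** Bernoulli's inequality for (1 + u)^n, together with
    (1 + u)^n (1 - u)^n <= 1. *)
Lemma natrX_sub1_le (R : realFieldType) (u : R) n : 0 < u -> u < 1 ->
  n%:R * (1 - u) ^+ n <= u^-1.
Proof.
move=> u0 u1; have bern m : 1 + m%:R * u <= (1 + u) ^+ m.
  elim: m => [|m IH]; first by rewrite mul0r addr0 expr0.
  rewrite exprS -natr1; have : 0 <= m%:R :> R by []. nra.
have r0 : 0 <= (1 - u) ^+ n by apply: exprn_ge0; lra.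
have : (1 + u) ^+ n * (1 - u) ^+ n <= 1.
  rewrite -exprMn; apply: exprn_ile1; nra.
have := ler_wpM2r r0 (bern n) => B1 B2.
rewrite -[leRHS]mul1r ler_pdivlMr //; nra.
Qed.

(** Choosing u with q <= (1 - u)^3 splits n^2 q^n into two bounded factors
    n (1 - u)^n and one factor (1 - u)^n that tends to 0. *)
Lemma cvg_sqr_geometric (R : realType) (q : R) : 0 <= q -> q < 1 ->
  n%:R ^+ 2 * q ^+ n @[n --> \oo] --> (0 : R).
Proof.
move=> q0 q1; pose u := (1 - q) / 3; have u0 : 0 < u by rewrite /u; lra.
have u1 : u < 1 by rewrite /u; lra.
have qu : q <= (1 - u) ^+ 3.
  by rewrite (_ : q = 1 - 3 * u); [rewrite !exprS expr0; nra|rewrite /u; field].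
apply: (@squeeze_cvgr _ _ _ _ (fun=> 0) (geometric (u^-1 ^+ 2) (1 - u))).
- near=> n; rewrite mulr_ge0 ?exprn_ge0 //=.
  apply: (@le_trans _ _ (n%:R ^+ 2 * ((1 - u) ^+ 3) ^+ n)).
    apply: ler_wpM2l; rewrite ?exprn_ge0 // lerXn2r ?nnegrE //.
    by apply: exprn_ge0; lra.
  have r0 : 0 <= (1 - u) ^+ n by apply: exprn_ge0; lra.
  have nr := natrX_sub1_le n u0 u1.
  rewrite exprAC /geometric /=; move: r0 nr; set r := (1 - u) ^+ n => r0 nr.
  rewrite (_ : _ * r ^+ 3 = (n%:R * r) ^+ 2 * r); last by ring.
  apply: ler_pM => //; rewrite ?exprn_ge0 ?mulr_ge0 // lerXn2r // nnegrE.
    by rewrite mulr_ge0.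
  by rewrite invr_ge0 ltW.
- exact: cvg_cst.
- by apply: cvg_geometric; rewrite ger0_norm; lra.
Unshelve. all: by end_near.
Qed.

Lemma cvg_series_telescope (R : realType) (u v : R^nat) :
  (forall n, u n = v n - v n.+1) -> v n @[n --> \oo] --> (0 : R) ->
  series u n @[n --> \oo] --> v 0%N.
Proof.
move=> uv v0; rewrite -[X in _ --> X]subr0.
rewrite (_ : series u = fun n => v 0%N - v n); last first.
  apply/funext => n; rewrite /series /=.
  rewrite -[RHS]opprB -(telescope_sumr v (leq0n n)) -sumrN.
  by apply: eq_bigr => i _; rewrite uv opprB.
by apply: cvgB => //; exact: cvg_cst.
Qed.

Lemma geometric_mean_series (R : realType) (x : R) : 0 < x -> x <= 1 ->
  series (fun n => n.+1%:R * (x * (1 - x) ^+ n)) n @[n --> \oo] --> x^-1.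
Proof.
move=> x0 x1; have q0 : 0 <= 1 - x by lra.
have q1 : 1 - x < 1 by lra.
(* The tail of the series from index n on. *)
pose v n := (n%:R + x^-1) * (1 - x) ^+ n.
have -> : x^-1 = v 0%N by rewrite /v expr0 add0r mulr1.
apply: cvg_series_telescope => [n|].
  rewrite /v [(1 - x) ^+ n.+1]exprS -natr1; field; lra.
have c1 := cvg_sqr_geometric q0 q1.
have c2 : geometric x^-1 (1 - x) n @[n --> \oo] --> (0 : R).
  by apply: cvg_geometric; rewrite ger0_norm.
apply: (@squeeze_cvgr _ _ _ _ (fun=> 0)
  (fun n => n%:R ^+ 2 * (1 - x) ^+ n + geometric x^-1 (1 - x) n)).
- near=> n; have r0 : 0 <= (1 - x) ^+ n by exact: exprn_ge0.
  have xV0 : 0 <= x^-1 by rewrite invr_ge0 ltW.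
  rewrite /v /geometric /= -mulrDl mulr_ge0 ?addr_ge0 //= ler_wpM2r //.
  apply: lerD => //; rewrite -natrX ler_nat.
  by case: (n) => // m; rewrite -mulnn leq_pmulr.
- exact: cvg_cst.
- by rewrite -[X in _ --> X]addr0; apply: cvgD.
Unshelve. all: by end_near.
Qed.

Lemma geometric_variance_series (R : realType) (x : R) : 0 < x -> x <= 1 ->
  series (fun n => (n.+1%:R - x^-1) ^+ 2 * (x * (1 - x) ^+ n)) n
    @[n --> \oo] --> (1 - x) / x ^+ 2.
Proof.
move=> x0 x1; have q0 : 0 <= 1 - x by lra.
have q1 : 1 - x < 1 by lra.
(* The tail of the series from index n on, found as the quadratic polynomial
   times (1 - x)^n whose successive differences are the terms. *)
pose v n := (n%:R ^+ 2 + (1 - x) / x ^+ 2) * (1 - x) ^+ n.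
have -> : (1 - x) / x ^+ 2 = v 0%N by rewrite /v expr0 expr0n add0r mulr1.
apply: cvg_series_telescope => [n|].
  rewrite /v [(1 - x) ^+ n.+1]exprS -natr1; field; lra.
rewrite (_ : v = fun n => n%:R ^+ 2 * (1 - x) ^+ n
    + geometric ((1 - x) / x ^+ 2) (1 - x) n); last first.
  by apply/funext => n; rewrite /v mulrDl.
rewrite -[X in _ --> X]addr0; apply: cvgD; first exact: cvg_sqr_geometric.
by apply: cvg_geometric; rewrite ger0_norm.
Qed.

(** The integral of a nonnegative function splits over the countably many level
    sets of X, on each of which g o X is constant. *)
Lemma expectation_nat d (T : measurableType d) (R : realType)
    (P : probability T R) (X : T -> nat) (g : nat -> R) (l : R) :
  measurable_fun setT X -> (forall n, 0 <= g n) ->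
  series (fun n => g n * fine (P [set w | X w = n])) n @[n --> \oo] --> l ->
  ('E_P[fun w => g (X w)] = l%:E)%E.
Proof.
move=> mX g0 gl; rewrite unlock.
have mL n : measurable [set w | X w = n] by exact: measurable_level_set.
have mg : measurable_fun setT (EFin \o (g \o X)).
  apply/measurable_EFinP.
  by apply: (measurableT_comp (f := g)) => // _ A _; exact: I.
have -> : [set: T] = \bigcup_n [set w | X w = n].
  by apply/seteqP; split=> w // _; exists (X w).
rewrite ge0_integral_bigcup //; last 3 first.
- exact: (measurable_funTS mg).
- by move=> w _; rewrite lee_fin.
- by move=> i j _ _ [w [/= <- <-]].
have termE n : (\int[P]_(w in [set w | X w = n]) (g (X w))%:E =
    (g n * fine (P [set w | X w = n]))%:E)%E.
  rewrite EFinM fineK ?fin_num_measure // -integral_cst //.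
  by apply: eq_integral => w; rewrite inE /= => ->.
rewrite (eq_eseriesr (fun n _ => termE n)).
apply/cvg_lim => //.
under eq_fun do rewrite sumEFin.
by apply/cvg_EFin => //; near=> n.
Unshelve. all: by end_near.
Qed.

(** * From the incentive process to the selling process *)

(** Both the level sets and the increments of Y = X + 1 are those of X, up to
    the shift of the state by one. The new state 0 is never visited. *)
Lemma pure_birth_shift d (T : measurableType d) (R : realType)
    (P : probability T R) (init : nat) (rate : nat -> R)
    (X Y : R -> T -> nat) :
  pure_birth_process P init (fun n => rate n.+1) X ->
  (forall t w, 0 <= t -> Y t w = (X t w).+1) ->
  pure_birth_process P init.+1 rate Y.
Proof.
case=> mX X0 incX birthX YX; split.
- move=> t t0; rewrite (_ : Y t = S \o X t); last first.
    by apply/funext => w; rewrite YX.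
  by apply: measurableT_comp (mX t t0) => // _ A _; exact: Logic.I.
- by move=> w; rewrite YX // X0.
- by move=> s t w s0 st; rewrite !YX ?ltnS; [exact: incX|lra|lra].
(* State 0 has probability zero, so its increment condition is vacuous. *)
case=> [|n].
  exists (fun _ _ => 0); split=> [r|t h r t0 h0].
    by apply/eqoP => e e0; near=> h; rewrite normr0 mulr_ge0 // ltW.
  rewrite (_ : [set w | Y t w = 0%N] = set0) ?measure0 ?ltxx //.
  by apply/seteqP; split=> w //=; rewrite YX.
have [err [erro errP]] := birthX n; exists err; split=> // t h r t0 h0.
have levelE : [set w | Y t w = n.+1] = [set w | X t w = n].
  apply/seteqP; split=> w /= E; last by rewrite YX // E.
  by apply/succn_inj; rewrite -YX.
have incrE : [set w | Y (t + h) w = (Y t w + r)%N] =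
    [set w | X (t + h) w = (X t w + r)%N].
  have th0 : 0 <= t + h by lra.
  apply/seteqP; split=> w /=; rewrite !YX // addSn => E; last by rewrite E.
  exact: succn_inj.
by rewrite levelE incrE; exact: errP.
Unshelve. all: by end_near.
Qed.

Theorem mainTheorem4 (d : measure_display) (T : measurableType d)
    (R : realType) (P : probability T R) (lambda : R) (N I : R -> T -> nat)
    (lambda_gt0 : 0 < lambda)
    (NI : selling_incentive_process P 1 lambda N I) :
  (forall t : R, 0 <= t ->
    [/\ (forall n : nat, (1 <= n)%N ->
          P [set w | N t w = n] =
          (expR (- (t * lambda)) * (1 - expR (- (t * lambda))) ^+ (n - 1))%:E),
        (forall s : R, `|s| <= 1 ->
          \sum_(1 <= n < m) fine (P [set w | N t w = n]) * s ^+ n @[m --> \oo]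
          --> expR (- (lambda * t)) * s
                / (1 - (1 - expR (- (lambda * t))) * s)),
        ('E_P[fun w => (N t w)%:R] = (expR (t * lambda))%:E)%E &
        ('V_P[fun w => (N t w)%:R]
          = (expR (t * lambda) * (expR (t * lambda) - 1))%:E)%E]) /\
  Yule_Furry_process P lambda N.
Proof.
have [bI NE] := NI; have {}NE t w : 0 <= t -> N t w = (I t w).+1.
  by move=> t0; rewrite NE // mul1n add1n.
split; last first.
  split=> [t w t0|]; first by rewrite NE.
  apply: pure_birth_shift NE.
  rewrite (_ : (fun n => n.+1%:R * lambda) =
    fun n => (n * 1 + 1)%:R * lambda) //.
  by apply/funext => n; rewrite muln1 addn1.
move=> t t0; have mI := pure_birth_measurable bI t0.
have lawI n : P [set w | I t w = n] = (geometric_law lambda n t)%:E.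
  exact: (selling_incentive_law lambda_gt0 NI).
have lawN n : P [set w | N t w = n.+1] = (geometric_law lambda n t)%:E.
  rewrite -lawI; congr (P _).
  apply/seteqP; split=> w /= E; last by rewrite NE // E.
  by apply/succn_inj; rewrite -NE.
have NIE : (fun w => (N t w)%:R) = (fun w => (I t w).+1%:R) :> (T -> R).
  by apply/funext => w; rewrite NE.
set x := expR (- (t * lambda)); have x0 : 0 < x by exact: expR_gt0.
have x1 : x <= 1 by rewrite -expR0 ler_expR oppr_le0 mulr_ge0 // ltW.
have xV : expR (t * lambda) = x^-1 by rewrite /x expRN invrK.
have expectI g l : (forall n, 0 <= g n) ->
    series (fun n => g n * (x * (1 - x) ^+ n)) n @[n --> \oo] --> l ->
    ('E_P[fun w => g (I t w)] = l%:E)%E.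
  move=> g0 gl; apply: expectation_nat => //.
  by under [X in series X]eq_fun do rewrite lawI /=.
have meanN : ('E_P[fun w => (N t w)%:R] = (x^-1)%:E)%E.
  rewrite NIE; apply: (expectI (fun n => n.+1%:R)) => //.
  exact: geometric_mean_series.
split.
- by case=> // n _; rewrite lawN subn1.
- move=> s s1; rewrite [lambda * t]mulrC -/x.
  have q1 : `|(1 - x) * s| < 1.
    by rewrite normrM ger0_norm; [nra|lra].
  (* The series starts at n = 1; shifting its partial sums makes it a
     geometric series starting at 0. *)
  pose G m := \sum_(1 <= n < m) fine (P [set w | N t w = n]) * s ^+ n.
  have partialE : [sequence G m.+1]_m =
      series (geometric (x * s) ((1 - x) * s)).
    apply/funext => m; rewrite /series /G /= big_add1 /=.
    apply: eq_bigr => n _; rewrite lawN /= /geometric_law -/x exprMn exprS.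
    by ring.
  by rewrite -(cvg_shiftS G) partialE; exact: cvg_geometric_series.
- by rewrite meanN xV.
- rewrite /variance unlock meanN /=.
  rewrite (_ : _ * _ = fun w => ((I t w).+1%:R - x^-1) ^+ 2); last first.
    by rewrite NIE.
  rewrite (expectI (fun n => (n.+1%:R - x^-1) ^+ 2) ((1 - x) / x ^+ 2)).
  + by rewrite xV; congr (_%:E); field; rewrite gt_eqF.
  + by move=> n; exact: sqr_ge0.
  + exact: geometric_variance_series.
Qed.
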